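(* In the setting of part 1 (so $\omega\in B(H)$ invertible, $\mathrm{Tr}(\omega^\dagger\omega)=1$, $T_{ij}=(1_{Y_j}\otimes\omega)\tilde\tau_{ij}$), suppose $M$ is entanglement-reversible with respect to $W_\omega$, and let $\kappa_{ij}$ be invertible operators such that each $V_j:\bigoplus_i(X_i\otimes E_{ji})\to Y_j\otimes H$, $(\xi_i)_i\mapsto\sum_iT_{ij}(1\otimes\kappa_{ij})\xi_i$, is an isometry. Let $U_i:X_i\otimes H\to\bigoplus_j(Y_j\otimes E_{ji})$, $\xi\mapsto(\tau_{ij}\xi)_j$ (always an isometry). Then $\dim A\le\dim B$; all the maps $U_i$ and $V_j$ are unitary if and only if $\dim A=\dim B$; and in that case the entanglement-left inverse of $M$ with respect to $W_\omega$ is unique and is given by $N\big(\bigoplus_j\rho_j\big)=\bigoplus_i\sum_j\mathrm{Tr}_{E_{ji}}\big[(1_{X_i}\otimes\kappa_{ij}^\dagger)T_{ij}^\dagger\rho_jT_{ij}(1_{X_i}\otimes\kappa_{ij})\big]$ for $\rho_j\in B(Y_j\otimes H)$.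
   Context: All Hilbert spaces are finite-dimensional. A channel is a completely positive trace-preserving linear map (acting on states). $A=\bigoplus_{i=1}^mB(X_i)$, $B=\bigoplus_{j=1}^nB(Y_j)$, $\dim A=\sum_i(\dim X_i)^2$, $A\otimes B(H)=\bigoplus_iB(X_i\otimes H)$; a channel $M:A\otimes B(H)\to B$ has components $M_{ij}:B(X_i\otimes H)\to B(Y_j)$ with $M(\oplus_i\rho_i)=\oplus_j\sum_iM_{ij}(\rho_i)$. A minimal dilation of $M$ is a family of linear maps $\tau_{ij}:X_i\otimes H\to Y_j\otimes E_{ji}$ with $M_{ij}(\rho)=\mathrm{Tr}_{E_{ji}}(\tau_{ij}\rho\tau_{ij}^\dagger)$ such that, for an orthonormal basis $\{e_k\}$ of $E_{ji}$, the operators $(1\otimes\langle e_k|)\tau_{ij}$ are linearly independent. With a fixed orthonormal basis $\{|h\rangle\}$ of $H$ and fixed orthonormal bases $\{e_k\}$ of the $E_{ji}$, $\tilde\tau_{ij}:X_i\otimes E_{ji}\to Y_j\otimes H$ is the linear map $\tilde\tau_{ij}(x\otimes e_k)=\sum_h[(1\otimes\langle e_k|)\tau_{ij}(x\otimes|h\rangle)]\otimes|h\rangle$. $W_\omega=|w_\omega\rangle\langle w_\omega|$ with $|w_\omega\rangle=\sum_h|h\rangle\otimes\omega|h\rangle\in H\otimes H$. Entanglement-reversibility: for a state $W$ on $H_1\otimes H_2$, a channel $M:A\otimes B(H_1)\to B$ is entanglement-reversible with respect to $W$ if there is a channel $N:B\otimes B(H_2)\to A$ (entanglement-left inverse) with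 $N\big((M\otimes\mathrm{id}_{B(H_2)})(\rho\otimes W)\big)=\rho$ for all $\rho\in A$. Here $H_1=H_2=H$. *)

(* Defs.v *)
(* Finite-dimensional Hilbert spaces are C^d (standard
   orthonormal basis), C an arbitrary numClosedFieldType (e.g. complex numbers).
   Operators X -> Y are matrices 'M_(dim Y, dim X) acting on column vectors.
   Tensor products use the Kronecker product [tensmx] of mathcomp-real-closed
   (index of x (x) y is [mxtens_index (x, y)]). *)
From HB Require Import structures.
From mathcomp Require Import all_boot all_order all_algebra.
From mathcomp Require Import mxtens.
Set Implicit Arguments. Unset Strict Implicit. Unset Printing Implicit Defensive.
Import Order.TTheory GRing.Theory Num.Theory.
Local Open Scope ring_scope.

Section QDefs.
Variable C : numClosedFieldType.

(* conjugate transpose A^dagger *)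
Definition adj {p q : nat} (A : 'M[C]_(p, q)) : 'M[C]_(q, p) :=
  (map_mx (fun z : C => z^*) A)^T.

(* positive semidefinite *)
Definition psd {p : nat} (A : 'M[C]_p) : Prop :=
  forall x : 'cV[C]_p, 0 <= (adj x *m A *m x) 0 0.

Definition qisometry {p q : nat} (V : 'M[C]_(p, q)) : Prop :=
  adj V *m V = 1%:M.

Definition qunitary {p q : nat} (V : 'M[C]_(p, q)) : Prop :=
  adj V *m V = 1%:M /\ V *m adj V = 1%:M.

(* partial trace over the second factor: Tr_E : B(Y (x) E) -> B(Y) *)
Definition ptrace {p e : nat} (S : 'M[C]_(p * e)) : 'M[C]_p :=
  \matrix_(a, b) \sum_(k < e) S (mxtens_index (a, k)) (mxtens_index (b, k)).

(* block (s,t) w.r.t. the second tensor factor: (1 (x) <s|) S (1 (x) |t>) *)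
Definition blk {p k : nat} (S : 'M[C]_(p * k)) (s t : 'I_k) : 'M[C]_p :=
  \matrix_(a, b) S (mxtens_index (a, s)) (mxtens_index (b, t)).

(* ampliation Phi (x) id_{B(C^k)} of a map Phi : B(C^p) -> B(C^q) *)
Definition ampl {p q k : nat} (Phi : 'M[C]_p -> 'M[C]_q) (S : 'M[C]_(p * k))
  : 'M[C]_(q * k) :=
  \sum_(s < k) \sum_(t < k) (Phi (blk S s t) *t (delta_mx s t : 'M[C]_k)).

Definition linmap {p q : nat} (Phi : 'M[C]_p -> 'M[C]_q) : Prop :=
  forall (c : C) (S T : 'M[C]_p), Phi (c *: S + T) = c *: Phi S + Phi T.

(* A linear map Phi : (+)_a B(C^(p a)) -> (+)_b B(C^(q b)), given by its
   components Phi a b, acting as Phi((+)_a r_a) = (+)_b sum_a Phi a b (r_a).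
   It is a channel iff linear, completely positive (Phi (x) id_k positive for
   every k, positivity in a direct sum meaning componentwise psd) and trace
   preserving (trace of a direct sum = sum of the traces). *)
Definition is_channel {ma mb : nat} {p : 'I_ma -> nat} {q : 'I_mb -> nat}
  (Phi : forall a b, 'M[C]_(p a) -> 'M[C]_(q b)) : Prop :=
  (forall a b, linmap (Phi a b)) /\
  (forall (k : nat) (r : forall a, 'M[C]_(p a * k)),
      (forall a, psd (r a)) ->
      forall b, psd (\sum_(a < ma) ampl (Phi a b) (r a))) /\
  (forall r : forall a, 'M[C]_(p a),
      \sum_(b < mb) \tr (\sum_(a < ma) Phi a b (r a)) = \sum_(a < ma) \tr (r a)).

(* r (x) W for r in B(X), W in B(H1 (x) H2), laid out on (X (x) H1) (x) H2 *)
Definition tensW {p k : nat} (r : 'M[C]_p) (W : 'M[C]_(k * k))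
  : 'M[C]_((p * k) * k) :=
  \sum_(s < k) \sum_(t < k) ((r *t blk W s t) *t (delta_mx s t : 'M[C]_k)).

(* |w_omega> = sum_h |h> (x) omega|h>,  W_omega = |w><w| *)
Definition wvec {k : nat} (om : 'M[C]_k) : 'cV[C]_(k * k) :=
  \sum_(h < k) ((delta_mx h 0 : 'cV[C]_k) *t (om *m (delta_mx h 0 : 'cV[C]_k))).
Definition Wom {k : nat} (om : 'M[C]_k) : 'M[C]_(k * k) :=
  wvec om *m adj (wvec om).

(* N : B (x) B(H2) -> A is an entanglement-left inverse of
   M : A (x) B(H1) -> B w.r.t. W  (here H1 = H2 = C^k). *)
Definition ent_left_inverse {m n : nat} {dX : 'I_m -> nat} {dY : 'I_n -> nat}
  {k : nat}
  (M : forall i j, 'M[C]_(dX i * k) -> 'M[C]_(dY j))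
  (W : 'M[C]_(k * k))
  (N : forall j i, 'M[C]_(dY j * k) -> 'M[C]_(dX i)) : Prop :=
  is_channel N /\
  forall r : forall i, 'M[C]_(dX i),
    forall i' : 'I_m,
      \sum_(j < n) N j i' (\sum_(i < m) ampl (M i j) (tensW (r i) W)) = r i'.

Definition ent_reversible {m n : nat} {dX : 'I_m -> nat} {dY : 'I_n -> nat}
  {k : nat}
  (M : forall i j, 'M[C]_(dX i * k) -> 'M[C]_(dY j))
  (W : 'M[C]_(k * k)) : Prop :=
  exists N : forall j i, 'M[C]_(dY j * k) -> 'M[C]_(dX i),
    ent_left_inverse M W N.

(* (1 (x) <e_l|) tau : X (x) H -> Y, for tau : X (x) H -> Y (x) E *)
Definition kraus_comp {px py e h : nat} (tau : 'M[C]_(py * e, px * h))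
  (l : 'I_e) : 'M[C]_(py, px * h) :=
  \matrix_(y, u) tau (mxtens_index (y, l)) u.

(* tau : X (x) H -> Y (x) E  is a minimal dilation of Phi : B(X (x) H) -> B(Y) *)
Definition minimal_dilation {px py e h : nat}
  (Phi : 'M[C]_(px * h) -> 'M[C]_py) (tau : 'M[C]_(py * e, px * h)) : Prop :=
  (forall r, Phi r = ptrace (tau *m r *m adj tau)) /\
  (forall c : 'I_e -> C,
      \sum_(l < e) c l *: kraus_comp tau l = 0 -> forall l, c l = 0).

(* tilde tau : X (x) E -> Y (x) H,
   tilde tau (x (x) e_l) = sum_h [(1 (x) <e_l|) tau (x (x) |h>)] (x) |h> *)
Definition tautilde {px py e h : nat} (tau : 'M[C]_(py * e, px * h))
  : 'M[C]_(py * h, px * e) :=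
  \matrix_(u, v)
    tau (mxtens_index ((mxtens_unindex u).1, (mxtens_unindex v).2))
        (mxtens_index ((mxtens_unindex v).1, (mxtens_unindex u).2)).

(* T = (1_Y (x) omega) tilde tau : X (x) E -> Y (x) H *)
Definition Tmat {px py e h : nat} (om : 'M[C]_h) (tau : 'M[C]_(py * e, px * h))
  : 'M[C]_(py * h, px * e) :=
  ((1%:M : 'M[C]_py) *t om) *m tautilde tau.

(* U_i : X_i (x) H -> (+)_j (Y_j (x) E_ji),  xi |-> (tau_ij xi)_j *)
Definition Umap {m n : nat} {dX : 'I_m -> nat} {dY : 'I_n -> nat} {h : nat}
  {dE : 'I_n -> 'I_m -> nat}
  (tau : forall i j, 'M[C]_(dY j * dE j i, dX i * h)) (i : 'I_m)
  : 'M[C]_(\sum_(j < n) (dY j * dE j i), dX i * h) :=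
  \mxcol_(j < n) tau i j.

(* V_j : (+)_i (X_i (x) E_ji) -> Y_j (x) H,  (xi_i)_i |-> sum_i T_ij (1 (x) kappa_ij) xi_i *)
Definition Vmap {m n : nat} {dX : 'I_m -> nat} {dY : 'I_n -> nat} {h : nat}
  {dE : 'I_n -> 'I_m -> nat}
  (om : 'M[C]_h)
  (tau : forall i j, 'M[C]_(dY j * dE j i, dX i * h))
  (kappa : forall i j, 'M[C]_(dE j i)) (j : 'I_n)
  : 'M[C]_(dY j * h, \sum_(i < m) (dX i * dE j i)) :=
  \mxrow_(i < m) (Tmat om (tau i j) *m ((1%:M : 'M[C]_(dX i)) *t kappa i j)).

(* N(rho_j) component j -> i :
   Tr_{E_ji}[(1 (x) kappa_ij^dag) T_ij^dag rho_j T_ij (1 (x) kappa_ij)] *)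
Definition Nform {m n : nat} {dX : 'I_m -> nat} {dY : 'I_n -> nat} {h : nat}
  {dE : 'I_n -> 'I_m -> nat}
  (om : 'M[C]_h)
  (tau : forall i j, 'M[C]_(dY j * dE j i, dX i * h))
  (kappa : forall i j, 'M[C]_(dE j i)) (j : 'I_n) (i : 'I_m)
  (r : 'M[C]_(dY j * h)) : 'M[C]_(dX i) :=
  let K := (1%:M : 'M[C]_(dX i)) *t kappa i j in
  let T := Tmat om (tau i j) in
  ptrace (adj K *m adj T *m r *m T *m K).

End QDefs.
Arguments Nform [C m n dX dY h dE] om tau kappa j i r.

(* Main.v *)
(** An ampliated channel acts on half of [Wom om] through the operators
    T_ij = (1 (x) om) tilde tau_ij, namely r |-> sum_i T_ij (r_i (x) 1) T_ij^dag.
    Since U_i and V_j are isometries, comparing dimensions gives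
    dH dim A <= sum_ij dim X_i dim Y_j dim E_ji <= dH dim B, with equality exactly
    when all of them are unitary.

    In the unitary case, conjugation by V_j turns the output into
    (+)_i r_i (x) sigma_ij with sigma_ij invertible and sum_j tr sigma_ij = 1, so
    the compression followed by the partial trace is a left inverse.  Let N be any
    other one, and let y be a vector of X_t.  The positive functional
    S |-> <y, N_jt(S) y> vanishes on the projections onto T_ij (x (x) e) if
    i <> t or x is orthogonal to y.  Hence the off-diagonal blocks do not
    contribute to N_jt, and N_jt maps the projection onto V_tj (x (x) e) to a
    multiple of |x><x|, which trace preservation identifies as |e|^2 |x><x|.
    Polarization in x and in e determines N. *)
Require Import Defs.
From HB Require Import structures.
From mathcomp Require Import all_boot all_order all_algebra.
From mathcomp Require Import mxtens ring.
Set Implicit Arguments. Unset Strict Implicit. Unset Printing Implicit Defensive.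
Import Order.TTheory GRing.Theory Num.Theory.
Local Open Scope ring_scope.

(** * Adjoints, sesquilinear forms and positive semidefinite matrices *)

Section Adjoint.
Variable C : numClosedFieldType.

Lemma dagE p q (A : 'M[C]_(p, q)) i j : adj A i j = (A j i)^*.
Proof. by rewrite !mxE. Qed.

Lemma dagK p q (A : 'M[C]_(p, q)) : adj (adj A) = A.
Proof. by apply/matrixP=> i j; rewrite !dagE conjCK. Qed.

Lemma dagM p q r (A : 'M[C]_(p, q)) (B : 'M_(q, r)) : adj (A *m B) = adj B *m adj A.
Proof. by rewrite /adj map_mxM trmx_mul. Qed.

Lemma dagD p q (A B : 'M[C]_(p, q)) : adj (A + B) = adj A + adj B.
Proof. by rewrite /adj map_mxD linearD. Qed.

Lemma dagZ p q c (A : 'M[C]_(p, q)) : adj (c *: A) = c^* *: adj A.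
Proof. by rewrite /adj map_mxZ linearZ. Qed.

Lemma dag0 p q : adj (0 : 'M[C]_(p, q)) = 0.
Proof. by rewrite /adj map_mx0 trmx0. Qed.

Lemma dag1 p : adj (1%:M : 'M[C]_p) = 1%:M.
Proof. by rewrite /adj map_mx1 trmx1. Qed.

Lemma dag_tens p q r s (A : 'M[C]_(p, q)) (B : 'M_(r, s)) :
  adj (A *t B) = adj A *t adj B.
Proof. by rewrite /adj map_mxT trmx_tens. Qed.

Lemma tr_dyad p (v w : 'cV[C]_p) : \tr (v *m adj w) = (adj w *m v) 0 0.
Proof. by rewrite mxtrace_mulC /mxtrace big_ord1. Qed.

Definition sform p (Z : 'M[C]_p) (y w : 'cV[C]_p) : C := (adj y *m Z *m w) 0 0.

Lemma sform0 p (y w : 'cV[C]_p) : sform 0 y w = 0.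
Proof. by rewrite /sform mulmx0 mul0mx mxE. Qed.

Lemma sformD p (Z T : 'M[C]_p) (y w : 'cV[C]_p) :
  sform (Z + T) y w = sform Z y w + sform T y w.
Proof. by rewrite /sform mulmxDr mulmxDl mxE. Qed.

Lemma sformZ p c (Z : 'M[C]_p) (y w : 'cV[C]_p) : sform (c *: Z) y w = c * sform Z y w.
Proof. by rewrite /sform -scalemxAr -scalemxAl mxE. Qed.

Lemma sform_sum p (I : Type) (s : seq I) (P : pred I) (F : I -> 'M[C]_p) y w :
  sform (\sum_(i <- s | P i) F i) y w = \sum_(i <- s | P i) sform (F i) y w.
Proof. by apply: (big_morph (fun Z => sform Z y w)) => [Z T|]; rewrite ?sformD ?sform0. Qed.

Lemma sformDl p (Z : 'M[C]_p) y y' w : sform Z (y + y') w = sform Z y w + sform Z y' w.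
Proof. by rewrite /sform dagD !mulmxDl mxE. Qed.

Lemma sformDr p (Z : 'M[C]_p) y w w' : sform Z y (w + w') = sform Z y w + sform Z y w'.
Proof. by rewrite /sform mulmxDr mxE. Qed.

Lemma sformZl p c (Z : 'M[C]_p) y w : sform Z (c *: y) w = c^* * sform Z y w.
Proof. by rewrite /sform dagZ -!scalemxAl mxE. Qed.

Lemma sformZr p c (Z : 'M[C]_p) y w : sform Z y (c *: w) = c * sform Z y w.
Proof. by rewrite /sform -scalemxAr mxE. Qed.

Lemma sform_dyad p (v w y z : 'cV[C]_p) :
  sform (v *m adj w) y z = (adj y *m v) 0 0 * (adj w *m z) 0 0.
Proof. by rewrite /sform mulmxA -mulmxA mxE big_ord1. Qed.

Lemma sform_deltal p (Z : 'M[C]_p) i w : sform Z (delta_mx i 0) w = (Z *m w) i 0.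
Proof.
rewrite /sform -mulmxA [LHS]mxE (bigD1 i) //= dagE mxE !eqxx conjC1 mul1r.
by rewrite big1 ?addr0 // => k ki; rewrite dagE mxE (negPf ki) conjC0 mul0r.
Qed.

Lemma sform_deltar p (Z : 'M[C]_p) y j : sform Z y (delta_mx j 0) = (adj y *m Z) 0 j.
Proof. by rewrite /sform -colE mxE. Qed.

Lemma sform_delta p (Z : 'M[C]_p) i j : sform Z (delta_mx i 0) (delta_mx j 0) = Z i j.
Proof. by rewrite sform_deltal -colE mxE. Qed.

Lemma dotC p (v w : 'cV[C]_p) : (adj v *m w) 0 0 = ((adj w *m v) 0 0)^*.
Proof. by rewrite -dagE dagM dagK. Qed.

Lemma dot_ge0 p (v : 'cV[C]_p) : 0 <= (adj v *m v) 0 0.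
Proof. by rewrite mxE sumr_ge0 // => i _; rewrite dagE mulrC mul_conjC_ge0. Qed.

Lemma dot_eq0 p (v : 'cV[C]_p) : (adj v *m v) 0 0 = 0 -> v = 0.
Proof.
rewrite mxE => /eqP; rewrite psumr_eq0; last by move=> i _; rewrite dagE mulrC mul_conjC_ge0.
move=> /allP h; apply/colP => i; rewrite mxE.
by have := h i (mem_index_enum _); rewrite dagE mulrC mul_conjC_eq0 => /eqP.
Qed.

Lemma psd_dyad p (v : 'cV[C]_p) : psd (v *m adj v).
Proof. by move=> x; rewrite -[X in 0 <= X]/(sform _ x x) sform_dyad [X in X * _]dotC mulrC mul_conjC_ge0. Qed.

Lemma psd_sum p (I : Type) (s : seq I) (P : pred I) (F : I -> 'M[C]_p) :
  (forall i, P i -> psd (F i)) -> psd (\sum_(i <- s | P i) F i).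
Proof.
move=> h x; rewrite -[X in 0 <= X]/(sform _ x x) sform_sum.
by apply: sumr_ge0 => i /h; apply.
Qed.

Lemma psd_conj p q (A : 'M[C]_(p, q)) S : psd S -> psd (adj A *m S *m A).
Proof. by move=> h x; have := h (A *m x); rewrite dagM !mulmxA. Qed.

(** Rescaling [c] by a real [t] gives an affine function nonnegative on the whole real line, so its
    slope is zero; [c = 1] and [c = 'i] then separate [p] from [q]. *)
Lemma affine_ge0 (r p q : C) :
  (forall c, 0 <= r + (c * p + c^* * q)) -> p = 0 /\ q = 0.
Proof.
move=> h.
have r0 : 0 <= r by have := h 0; rewrite conjC0 !mul0r !addr0.
have z0 : forall l, (forall t, t \is Num.real -> 0 <= r + t * l) -> l = 0.
  move=> l hl; apply/eqP/negPn/negP => l0.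
  have lr : l \is Num.real.
    rewrite (_ : l = (r + 1 * l) - r); last by rewrite mul1r addrC addKr.
    by apply: rpredB; apply: ger0_real => //; apply: hl; rewrite rpred1.
  (* At this [t], real because [l] is, the affine function takes the value [-1]. *)
  have := hl (- (r + 1) / l); rewrite divfK // => H.
  have : 0 <= r + - (r + 1).
    by apply: H; rewrite rpredM ?rpredV // rpredN rpredD ?rpred1 // ger0_real.
  by rewrite opprD addrA subrr sub0r oppr_ge0 ler10.
have e : forall c, c * p + c^* * q = 0.
  move=> c; apply: z0 => t tr; have := h (t * c).
  by rewrite rmorphM /= (conj_Creal tr) -!mulrA -mulrDr.
have e1 : p = - q by have := e 1; rewrite conjC1 !mul1r => /eqP; rewrite addr_eq0 => /eqP.
have := e 'i; rewrite conjCi e1 mulrN mulNr -opprD => /eqP; rewrite oppr_eq0 -mulrDr mulf_eq0.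
rewrite (negPf (neq0Ci C)) /= -mulr2n mulrn_eq0 /= => /eqP q0.
by rewrite q0 oppr0.
Qed.

(** Plays the role of Cauchy-Schwarz: the form at [w + c *: v] has no quadratic term in [c], so
    [affine_ge0] kills both cross terms. *)
Lemma psd_ker p (Z : 'M[C]_p) v :
  psd Z -> sform Z v v = 0 -> Z *m v = 0 /\ adj v *m Z = 0.
Proof.
move=> hZ hv.
have k w : sform Z w v = 0 /\ sform Z v w = 0.
  apply: (@affine_ge0 (sform Z w w)) => c.
  have := hZ (w + c *: v); rewrite -[X in 0 <= X]/(sform _ _ _).
  rewrite sformDl !sformDr !sformZl !sformZr hv !mulr0 addr0.
  by rewrite -!addrA.
split; [apply/colP => i | apply/rowP => i]; rewrite [RHS]mxE.
  by have [h _] := k (delta_mx i 0); rewrite -sform_deltal.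
by have [_ h] := k (delta_mx i 0); rewrite -sform_deltar.
Qed.

(* No division by [|x|^4], so that [x = 0] is harmless. *)
Lemma psd_rank1 p (Z : 'M[C]_p) x : psd Z ->
  (forall y, (adj y *m x) 0 0 = 0 -> sform Z y y = 0) ->
  ((adj x *m x) 0 0) ^+ 2 *: Z = sform Z x x *: (x *m adj x).
Proof.
move=> hZ hk; set d : C := (adj x *m x) 0 0.
have dr : d^* = d by apply: conj_Creal; apply: ger0_real; apply: dot_ge0.
have dE : (adj x *m x) 0 0 = d by [].
clearbody d.
have subE (A B : 'M[C]_1) : (A - B) 0 0 = A 0 0 - B 0 0 by rewrite !mxE.
have scaleE (a : C) (A : 'M[C]_1) : (a *: A) 0 0 = a * A 0 0 by rewrite !mxE.
(* The vector is [d] times the component of [y] orthogonal to [x], hence isotropic by [hk] and in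
   both kernels by [psd_ker]. *)
have k y : Z *m (d *: y - (adj x *m y) 0 0 *: x) = 0
   /\ adj (d *: y - (adj x *m y) 0 0 *: x) *m Z = 0.
  apply: psd_ker => //; apply: hk; rewrite dotC mulmxBr -!scalemxAr subE !scaleE.
  by rewrite dE mulrC subrr conjC0.
have e1 : d *: Z = (Z *m x) *m adj x.
  apply/matrixP => i j; have [+ _] := k (delta_mx j 0).
  rewrite mulmxBr -!scalemxAr => /eqP; rewrite subr_eq0 => /eqP /colP/(_ i).
  rewrite -!colE [LHS]mxE [RHS]mxE.
  rewrite [col j Z i 0]mxE [col j (adj x) 0 0]mxE => e.
  by rewrite mxE e [RHS]mxE big_ord1 mulrC.
have e2 : d *: Z = x *m (adj x *m Z).
  apply/matrixP => i j; have [_] := k (delta_mx i 0).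
  rewrite dagD -scaleNr !dagZ mulmxDl -!scalemxAl dr rmorphN /= scaleNr -dotC.
  move=> /eqP; rewrite subr_eq0 => /eqP /rowP/(_ j).
  rewrite [LHS]mxE [RHS]mxE -sform_deltar sform_delta => e.
  rewrite mxE e [RHS]mxE big_ord1; congr (_ * _).
  by rewrite -[x]mul1mx mulmxA -[LHS]/(sform 1%:M _ _) sform_deltal !mul1mx.
(* Using [e1] on the right and [e2] on the left leaves [adj x *m Z *m x], a scalar, between [x] and
   [adj x]. *)
rewrite expr2 -scalerA e1 !scalemxAl e2.
have -> : x *m (adj x *m Z) *m x = x *m (adj x *m Z *m x) by rewrite !mulmxA.
rewrite [adj x *m Z *m x]mx11_scalar mul_mx_scalar -scalemxAl; by [].
Qed.
End Adjoint.

(** * Positive maps, polarization and the components of a channel *)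

Section PositiveMaps.
Variable C : numClosedFieldType.

Section LinMap.
Variables (p q : nat) (Phi : 'M[C]_p -> 'M[C]_q).
Hypothesis linPhi : linmap Phi.

Lemma linmap0 : Phi 0 = 0.
Proof. by have := linPhi (-1) 0 0; rewrite scaler0 add0r scaleN1r addNr. Qed.

Lemma linmapD S T : Phi (S + T) = Phi S + Phi T.
Proof. by have := linPhi 1 S T; rewrite !scale1r. Qed.

Lemma linmapZ c S : Phi (c *: S) = c *: Phi S.
Proof. by have := linPhi c S 0; rewrite linmap0 !addr0. Qed.

Lemma linmap_sum (I : Type) (s : seq I) (P : pred I) F :
  Phi (\sum_(i <- s | P i) F i) = \sum_(i <- s | P i) Phi (F i).
Proof. by apply: (big_morph Phi); [apply: linmapD | apply: linmap0]. Qed.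

Lemma dyad_expand (v w : 'cV[C]_p) c :
  (w + c *: v) *m adj (w + c *: v)
  = w *m adj w + (c *: (v *m adj w) + c^* *: (w *m adj v)) + (c * c^*) *: (v *m adj v).
Proof.
rewrite dagD dagZ !mulmxDl !mulmxDr -!scalemxAl -!scalemxAr scalerA -!addrA.
by congr (_ + _); rewrite addrCA.
Qed.

(** Expanding the dyad of [z + c *: y] at [c = 1] and [c = 'i] isolates the two cross terms. *)
Lemma linmap_polar : (forall y : 'cV[C]_p, Phi (y *m adj y) = 0) ->
  forall y z : 'cV[C]_p, Phi (y *m adj z) = 0.
Proof.
move=> h y z.
have e c : c *: Phi (y *m adj z) + c^* *: Phi (z *m adj y) = 0.
  have := h (z + c *: y); rewrite dyad_expand !linmapD !linmapZ !h.
  by rewrite scaler0 addr0 add0r.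
have := e 1; rewrite conjC1 !scale1r => /eqP; rewrite addr_eq0 => /eqP e1.
have := e 'i; rewrite conjCi e1 scalerN scaleNr -opprD => /eqP.
rewrite oppr_eq0 -mulr2n -scaler_nat scalerA scaler_eq0 mulf_eq0 pnatr_eq0 /=.
by rewrite (negPf (neq0Ci C)) /= => /eqP ->; rewrite oppr0.
Qed.

Hypothesis posPhi : forall S, psd S -> psd (Phi S).

(** The functional [S |-> sform (Phi S) y y] is nonnegative on the dyad of [w + c *: v], where its
    quadratic term in [c] vanishes; [affine_ge0] applies again. *)
Lemma pos_ker y (v w : 'cV[C]_p) : sform (Phi (v *m adj v)) y y = 0 ->
  sform (Phi (v *m adj w)) y y = 0 /\ sform (Phi (w *m adj v)) y y = 0.
Proof.
move=> hv; apply: (@affine_ge0 _ (sform (Phi (w *m adj w)) y y)) => c.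
have := posPhi (psd_dyad (w + c *: v)) y; rewrite -[X in 0 <= X]/(sform _ y y).
by rewrite dyad_expand !linmapD !linmapZ !sformD !sformZ hv mulr0 addr0.
Qed.

(** Null vectors of the functional thus spread to their span, since only one slot of the dyad has to
    be expanded. *)
Lemma pos_ker_sum y (I : finType) (c : I -> C) (v : I -> 'cV[C]_p) :
  (forall l, sform (Phi (v l *m adj (v l))) y y = 0) ->
  forall w, sform (Phi ((\sum_l c l *: v l) *m adj w)) y y = 0
         /\ sform (Phi (w *m adj (\sum_l c l *: v l))) y y = 0.
Proof.
move=> h w; have adj_sum (F : I -> 'cV[C]_p) : adj (\sum_l F l) = \sum_l adj (F l).
  by apply: (big_morph (@adj C p 1)); [apply: dagD | apply: dag0].
rewrite adj_sum mulmx_suml mulmx_sumr !linmap_sum !sform_sum; split.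
  by apply: big1 => l _; rewrite -scalemxAl linmapZ sformZ (pos_ker w (h l)).1 mulr0.
by apply: big1 => l _; rewrite dagZ -scalemxAr linmapZ sformZ (pos_ker w (h l)).2 mulr0.
Qed.

End LinMap.

Lemma sform_eq0 p (Z : 'M[C]_p) : (forall y, sform Z y y = 0) -> Z = 0.
Proof.
move=> h; apply/matrixP => i j; rewrite mxE -sform_delta.
(* The trace functional takes values in matrices of size one so that [linmap_polar] covers it. *)
have lt : @linmap C p 1 (fun S => (\tr (Z *m S))%:M).
  move=> c S T; apply/matrixP => a b.
  by rewrite mulmxDr -scalemxAr linearD linearZ /= !mxE mulrnDl mulrnAr.
have e y z : \tr (Z *m (y *m adj z)) = sform Z z y by rewrite mulmxA tr_dyad mulmxA.
have /(_ _)/matrixP := linmap_polar lt _ (delta_mx j 0) (delta_mx i 0).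
move/(_ _ 0 0); rewrite !mxE e mulr1n; apply => y.
by apply/matrixP => a b; rewrite !mxE e h mul0rn.
Qed.

(** Reindexing is conjugation by the 0-1 matrix [colsub f 1%:M], even for [f] not injective. *)
Lemma psd_mxsub p q (f : 'I_q -> 'I_p) (R : 'M[C]_p) : psd R -> psd (mxsub f f R).
Proof.
have -> : mxsub f f R = adj (colsub f 1%:M) *m R *m colsub f 1%:M.
  have -> : adj (colsub f (1%:M : 'M[C]_p)) = rowsub f 1%:M.
    by apply/matrixP => i j; rewrite dagE !mxE eq_sym conjC_nat.
  by rewrite mulmx_colsub mul_rowsub_mx mulmx1 mul1mx; apply/matrixP => i j; rewrite !mxE.
exact: psd_conj.
Qed.

Lemma big_mxtens (R : nmodType) p q (F : 'I_(p * q) -> R) :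
  \sum_u F u = \sum_a \sum_b F (mxtens_index (a, b)).
Proof.
rewrite pair_big /= (reindex (@mxtens_index p q)) /=; first by apply: eq_bigr => -[].
by exists (@mxtens_unindex p q) => i _; rewrite (mxtens_indexK, mxtens_unindexK).
Qed.

Lemma sum_blocksE p k (F : 'I_k -> 'I_k -> 'M[C]_p) a b s t :
  (\sum_s \sum_t (F s t *t (delta_mx s t : 'M[C]_k)))
     (mxtens_index (a, s)) (mxtens_index (b, t)) = F s t a b.
Proof.
rewrite summxE (bigD1 s) //= summxE (bigD1 t) //= tensmxE mxE !eqxx mulr1.
rewrite big1 ?addr0 => [|t' tt']; last by rewrite tensmxE mxE eqxx eq_sym (negPf tt') mulr0.
rewrite big1 ?addr0 // => s' ss'; rewrite summxE big1 // => t' _.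
by rewrite tensmxE mxE eq_sym (negPf ss') mulr0.
Qed.

Lemma amplE p q k (Phi : 'M[C]_p -> 'M[C]_q) S a b s t :
  @ampl C p q k Phi S (mxtens_index (a, s)) (mxtens_index (b, t)) = Phi (blk S s t) a b.
Proof. exact: sum_blocksE. Qed.

Lemma mxtensP (m n p q : nat) (A B : 'M[C]_(m * n, p * q)) :
  (forall a s b t, A (mxtens_index (a, s)) (mxtens_index (b, t))
                 = B (mxtens_index (a, s)) (mxtens_index (b, t))) -> A = B.
Proof.
by move=> h; apply/matrixP => u v; case: (mxtens_indexP u) => a s; case: (mxtens_indexP v).
Qed.

Section Channel.
Variables (ma mb : nat) (p : 'I_ma -> nat) (q : 'I_mb -> nat).
Variable Phi : forall a b, 'M[C]_(p a) -> 'M[C]_(q b).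
Hypothesis chPhi : is_channel Phi.

Lemma channel_lin a b : linmap (@Phi a b).
Proof. by have [h _] := chPhi. Qed.

(** Complete positivity is used with [k = 1] on the family supported in the summand [a]. *)
Lemma channel_pos a b S : psd S -> psd (@Phi a b S).
Proof.
have [_ [cp _]] := chPhi => hS.
(* The size [p a * 1] does not convert to [p a], so [S] is transported by reindexing, and back again
   below. *)
pose R : 'M[C]_(p a * 1) := mxsub (fun u => (mxtens_unindex u).1) (fun u => (mxtens_unindex u).1) S.
have hR a' : psd (dfwith (fun a' => 0 : 'M[C]_(p a' * 1)) R a').
  case: dfwithP => [|a'' _]; first exact: psd_mxsub.
  by move=> x; rewrite mulmx0 mul0mx mxE.
have := psd_mxsub (fun u => mxtens_index (u, 0)) (cp 1 _ hR b).
congr psd; apply/matrixP => u v; rewrite mxE summxE (bigD1 a) //= dfwith_in amplE.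
rewrite big1 ?addr0; last first.
  move=> a' a'a; rewrite dfwith_out 1?eq_sym // amplE.
  have -> : blk (0 : 'M[C]_(p a' * 1)) 0 0 = 0 by apply/matrixP => x y; rewrite !mxE.
  by rewrite linmap0 ?mxE //; exact: channel_lin.
by congr (@Phi a b _ u v); apply/matrixP => x y; rewrite !mxE !mxtens_indexK.
Qed.

Lemma channel_tr a S : \sum_b \tr (@Phi a b S) = \tr S.
Proof.
have [_ [_ tp]] := chPhi.
have := tp (dfwith (fun a' => 0 : 'M[C]_(p a')) S).
rewrite [RHS](bigD1 a) //= dfwith_in [X in _ = _ + X]big1 ?addr0; last first.
  by move=> a' a'a; rewrite dfwith_out 1?eq_sym // mxtrace0.
move=> <-; apply: eq_bigr => b _; congr (\tr _).
rewrite (bigD1 a) //= dfwith_in big1 ?addr0 // => a' a'a.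
by rewrite dfwith_out 1?eq_sym // linmap0 //; exact: channel_lin.
Qed.

End Channel.
End PositiveMaps.

(** * Blocks, partial traces and the Kraus form of the output on [Wom om] *)

Section Kraus.
Variable C : numClosedFieldType.

Lemma mul_tens1l p q k n (A : 'M[C]_(p, q)) (S : 'M_(q * k, n)) a s v :
  ((A *t (1%:M : 'M_k)) *m S) (mxtens_index (a, s)) v
  = \sum_u A a u * S (mxtens_index (u, s)) v.
Proof.
rewrite mxE big_mxtens; apply: eq_bigr => u _.
rewrite (bigD1 s) //= tensmxE mxE eqxx mulr1 big1 ?addr0 // => s' ss'.
by rewrite tensmxE mxE eq_sym (negPf ss') mulr0 mul0r.
Qed.

Lemma mul_tens1r p q k n (A : 'M[C]_(p, q)) (S : 'M_(n, p * k)) v b t :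
  (S *m (A *t (1%:M : 'M_k))) v (mxtens_index (b, t))
  = \sum_u S v (mxtens_index (u, t)) * A u b.
Proof.
rewrite mxE big_mxtens; apply: eq_bigr => u _.
rewrite (bigD1 t) //= tensmxE mxE eqxx mulr1 big1 ?addr0 // => s' ss'.
by rewrite tensmxE mxE (negPf ss') !mulr0.
Qed.

Lemma blk_conj_tens1 p q k (A : 'M[C]_(p, q)) (S : 'M_(p * k)) s t :
  blk (adj (A *t (1%:M : 'M_k)) *m S *m (A *t 1%:M)) s t = adj A *m blk S s t *m A.
Proof.
apply/matrixP => a b; rewrite mxE mul_tens1r [RHS]mxE; apply: eq_bigr => u _.
rewrite dag_tens dag1 mul_tens1l; congr (_ * _); rewrite mxE; apply: eq_bigr => v _.
by rewrite [X in _ = _ * X]mxE.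
Qed.

Lemma trace_mxtens p k (S : 'M[C]_(p * k)) :
  \tr S = \sum_a \sum_s S (mxtens_index (a, s)) (mxtens_index (a, s)).
Proof. by rewrite /mxtrace big_mxtens. Qed.

Lemma trace_ptrace p k (S : 'M[C]_(p * k)) : \tr (ptrace S) = \tr S.
Proof. by rewrite trace_mxtens; apply: eq_bigr => a _; rewrite mxE. Qed.

Lemma trace_blk p k (S : 'M[C]_(p * k)) : \tr S = \sum_s \tr (blk S s s).
Proof.
rewrite trace_mxtens exchange_big /=; apply: eq_bigr => s _.
by apply: eq_bigr => a _; rewrite mxE.
Qed.

Lemma trace_tens p k (A : 'M[C]_p) (B : 'M[C]_k) : \tr (A *t B) = \tr A * \tr B.
Proof.
rewrite trace_mxtens mulr_suml; apply: eq_bigr => a _.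
by rewrite mulr_sumr; apply: eq_bigr => s _; rewrite tensmxE.
Qed.

Lemma ptrace_tens p k (A : 'M[C]_p) (B : 'M[C]_k) : ptrace (A *t B) = \tr B *: A.
Proof.
apply/matrixP => a b; rewrite !mxE mulr_suml; apply: eq_bigr => s _.
by rewrite tensmxE mulrC.
Qed.

Lemma ptraceD p k (S T : 'M[C]_(p * k)) : ptrace (S + T) = ptrace S + ptrace T.
Proof. by apply/matrixP => a b; rewrite !mxE -big_split; apply: eq_bigr => s _; rewrite mxE. Qed.

Lemma ptraceZ p k c (S : 'M[C]_(p * k)) : ptrace (c *: S) = c *: ptrace S.
Proof. by apply/matrixP => a b; rewrite !mxE mulr_sumr; apply: eq_bigr => s _; rewrite mxE. Qed.

Lemma ptrace_conj_linmap P p k (B : 'M[C]_(P, p * k)) :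
  linmap (fun r : 'M[C]_P => ptrace (adj B *m r *m B)).
Proof.
by move=> c S T; rewrite mulmxDr mulmxDl -scalemxAr -scalemxAl ptraceD ptraceZ.
Qed.

(** The slices [A l] of [B] along the traced factor give the Kraus form: the ampliation is a sum of
    conjugations by [A l *t 1%:M]. *)
Lemma ptrace_conj_cp P p e k (B : 'M[C]_(P, p * e)) (S : 'M[C]_(P * k)) :
  psd S -> psd (ampl (fun r => ptrace (adj B *m r *m B)) S).
Proof.
move=> hS; pose A l : 'M[C]_(P, p) := colsub (fun a => mxtens_index (a, l)) B.
have -> : ampl (fun r => ptrace (adj B *m r *m B)) S
    = \sum_l adj (A l *t (1%:M : 'M_k)) *m S *m (A l *t 1%:M).
  apply: mxtensP => a s b t; rewrite amplE summxE mxE; apply: eq_bigr => l _.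
  have /matrixP/(_ a b) := blk_conj_tens1 (A l) S s t; rewrite mxE => ->.
  have -> : adj (A l) = rowsub (fun a => mxtens_index (a, l)) (adj B).
    by apply/matrixP => i j; rewrite !mxE.
  rewrite mulmx_colsub !mul_rowsub_mx [RHS]mxE. by rewrite [RHS]mxE.
by apply: psd_sum => l _; exact: psd_conj.
Qed.

Lemma TmatE px py e h (om : 'M[C]_h) (tau : 'M[C]_(py * e, px * h)) y s x l :
  Tmat om tau (mxtens_index (y, s)) (mxtens_index (x, l))
  = \sum_h0 om s h0 * tau (mxtens_index (y, l)) (mxtens_index (x, h0)).
Proof.
rewrite /Tmat mxE big_mxtens (bigD1 y) //= [X in _ + X]big1 ?addr0; last first.
  move=> y' y'y; apply: big1 => s' _.
  by rewrite tensmxE mxE eq_sym (negPf y'y) !mul0r.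
by apply: eq_bigr => s' _; rewrite tensmxE !mxE !mxtens_indexK eqxx mul1r.
Qed.

Lemma blk_tensW p k (r : 'M[C]_p) (W : 'M[C]_(k * k)) s t :
  blk (tensW r W) s t = r *t blk W s t.
Proof. by apply/matrixP => u v; rewrite mxE sum_blocksE. Qed.

(** The width [1 * 1] of [x *t e] converts to [1]; the type annotation makes product vectors
    columns. *)
Definition tensv p q (x : 'cV[C]_p) (e : 'cV[C]_q) : 'cV[C]_(p * q) := x *t e.

Lemma tensvE p q (x : 'cV[C]_p) (e : 'cV[C]_q) a b :
  tensv x e (mxtens_index (a, b)) 0 = x a 0 * e b 0.
Proof. by rewrite mxE mxtens_indexK; congr (x _ _ * e _ _); apply: ord1. Qed.

Lemma wvecE k (om : 'M[C]_k) h s : wvec om (mxtens_index (h, s)) 0 = om s h.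
Proof.
rewrite /wvec summxE (bigD1 h) //= [X in X + _]tensvE -colE !mxE !eqxx mul1r.
rewrite big1 ?addr0 // => h' h'h.
by rewrite [LHS]tensvE mxE eq_sym (negPf h'h) mul0r.
Qed.

Lemma blk_Wom k (om : 'M[C]_k) s t h h' : blk (Wom om) s t h h' = om s h * (om t h')^*.
Proof. by rewrite mxE /Wom mxE big_ord1 dagE !wvecE. Qed.

Lemma trace_Wom k (om : 'M[C]_k) : \tr (Wom om) = \tr (adj om *m om).
Proof.
rewrite trace_blk mxtrace_mulC; apply: eq_bigr => s _; rewrite mxE.
by apply: eq_bigr => h _; rewrite blk_Wom dagE.
Qed.

(** Entrywise both sides are one sum: the environment index [l] is summed by the partial trace on
    the left and by [1%:M] on the right, while [Wom om] contracts the [H] input of [tau] with [om],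
    as [Tmat] does. *)
Lemma ampl_tensW px py e h (Phi : 'M[C]_(px * h) -> 'M[C]_py) (om : 'M[C]_h)
    (tau : 'M[C]_(py * e, px * h)) (r : 'M[C]_px) :
  (forall S, Phi S = ptrace (tau *m S *m adj tau)) ->
  ampl Phi (tensW r (Wom om))
  = Tmat om tau *m (r *t (1%:M : 'M_e)) *m adj (Tmat om tau).
Proof.
move=> hPhi; apply: mxtensP => y s y' t; rewrite amplE blk_tensW hPhi.
rewrite mxE [RHS]mxE big_mxtens exchange_big /=; apply: eq_bigr => l _.
rewrite mxE big_mxtens; apply: eq_bigr => x' _.
rewrite mul_tens1r dagE TmatE rmorph_sum mulr_sumr; apply: eq_bigr => h' _.
rewrite mxE big_mxtens !mulr_suml; apply: eq_bigr => x _.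
rewrite TmatE !mulr_suml; apply: eq_bigr => h0 _.
rewrite tensmxE blk_Wom dagE rmorphM /=.
by ring.
Qed.

End Kraus.

(** * Isometries, block rows and product vectors *)

Section Isometries.
Variable C : numClosedFieldType.

Lemma adj_mxrow n p (q : 'I_n -> nat) (B : forall i, 'M[C]_(p, q i)) :
  adj (\mxrow_i B i) = \mxcol_i adj (B i).
Proof. by apply/matrixP => u v; rewrite !mxE. Qed.

Lemma adj_mxcol n p (q : 'I_n -> nat) (B : forall i, 'M[C]_(q i, p)) :
  adj (\mxcol_i B i) = \mxrow_i adj (B i).
Proof. by apply/matrixP => u v; rewrite !mxE. Qed.

Lemma qisometry_mxrow n p (q : 'I_n -> nat) (B : forall i, 'M[C]_(p, q i)) :
  qisometry (\mxrow_i B i) ->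
  (forall i, qisometry (B i)) /\ (forall i i' : 'I_n, i != i' -> adj (B i) *m B i' = 0).
Proof.
rewrite /qisometry adj_mxrow mul_mxcol_mxrow -mxdiagZ /mxdiag => /eq_mxblockP h.
split=> [i | i i' ii']; rewrite h ?(negPf ii') //.
by rewrite eqxx conform_mx_id.
Qed.

(** The identity of size [q] factors through dimension [p], which bounds its rank. *)
Lemma qisometry_leq p q (V : 'M[C]_(p, q)) : qisometry V -> (q <= p)%N.
Proof.
move=> hV; rewrite -[leqLHS](mxrank1 C) -hV.
by apply: leq_trans (mxrankM_maxr _ _) (rank_leq_row _).
Qed.

Lemma qunitaryP p q (V : 'M[C]_(p, q)) : qisometry V -> (qunitary V <-> p = q).
Proof.
move=> hV; split=> [[_ hV']|pq].
  apply/eqP; rewrite eqn_leq (qisometry_leq hV) andbT.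
  by apply: (@qisometry_leq _ _ (adj V)); rewrite /qisometry dagK.
by split=> //; case: q / pq in V hV *; exact: mulmx1C.
Qed.

Lemma mulmx_col_row p q r (A : 'M[C]_(p, q)) (B : 'M_(q, r)) :
  A *m B = \sum_u col u A *m row u B.
Proof.
apply/matrixP => i j; rewrite mxE summxE; apply: eq_bigr => u _.
by rewrite mxE big_ord1 !mxE.
Qed.

Lemma dag_delta p i : adj (delta_mx i 0 : 'cV[C]_p) = delta_mx 0 i.
Proof. by apply/matrixP => u v; rewrite dagE !mxE conjC_nat andbC. Qed.

Lemma tens11 p q : (1%:M : 'M[C]_p) *t (1%:M : 'M[C]_q) = 1%:M.
Proof.
apply: mxtensP => a s b t; rewrite tensmxE !mxE (can_eq (@mxtens_indexK p q)).
by rewrite xpair_eqE -natrM mulnb.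
Qed.

Lemma tensv_dyad p q (x z : 'cV[C]_p) (e f : 'cV[C]_q) :
  (x *m adj z) *t (e *m adj f) = tensv x e *m adj (tensv z f).
Proof.
apply: mxtensP => a s b t; rewrite tensmxE !mxE !big_ord1 !dagE !tensvE rmorphM /=.
by rewrite mulrACA.
Qed.

Lemma tensv_sum p q (x : 'cV[C]_p) (e : 'cV[C]_q) :
  tensv x e = \sum_l e l 0 *: tensv x (delta_mx l 0).
Proof.
apply/colP => u; case: (mxtens_indexP u) => a s; rewrite summxE tensvE (bigD1 s) //=.
rewrite [in RHS]mxE tensvE mxE !eqxx mulr1 mulrC big1 ?addr0 // => l ls.
by rewrite mxE tensvE mxE eq_sym (negPf ls) !mulr0.
Qed.

Lemma tensv_delta p q (a : 'I_p) (s : 'I_q) :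
  tensv (delta_mx a 0) (delta_mx s 0) = delta_mx (mxtens_index (a, s)) 0 :> 'cV[C]_(p * q).
Proof.
apply/colP => u; case: (mxtens_indexP u) => b t; rewrite tensvE !mxE !andbT.
by rewrite (can_eq (@mxtens_indexK p q)) xpair_eqE -natrM mulnb.
Qed.

(** Resolving the identity into basis dyads exhibits the channel output as a sum of dyads, to which
    positivity applies term by term. *)
Lemma dyad_tens1 p q (x : 'cV[C]_p) :
  (x *m adj x) *t (1%:M : 'M[C]_q)
  = \sum_l tensv x (delta_mx l 0) *m adj (tensv x (delta_mx l 0)).
Proof.
have -> : (1%:M : 'M[C]_q) = \sum_l delta_mx l 0 *m adj (delta_mx l 0 : 'cV_q).
  by rewrite -[LHS]mulmx1 mulmx_col_row; apply: eq_bigr => l _; rewrite dag_delta colE mul1mx rowE mulmx1.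
rewrite (big_morph (fun B => (x *m adj x) *t B) (id1 := 0) (op1 := +%R)); first last.
- by apply: tensmx0.
- by move=> A B; apply/matrixP => i j; rewrite !mxE mulrDr.
by apply: eq_bigr => l _; rewrite tensv_dyad.
Qed.

Lemma mul_1tens_tensv p q (K : 'M[C]_q) (x : 'cV[C]_p) e :
  ((1%:M : 'M_p) *t K) *m tensv x e = tensv x (K *m e).
Proof. by rewrite /tensv (@tensmx_mul _ _ _ _ _ 1 1) mul1mx. Qed.

Lemma dot_tensv p q (x : 'cV[C]_p) (e : 'cV[C]_q) :
  (adj (tensv x e) *m tensv x e) 0 0 = (adj x *m x) 0 0 * (adj e *m e) 0 0.
Proof. by rewrite -tr_dyad -tensv_dyad trace_tens !tr_dyad. Qed.

(** Polarize in [x], then in [e]; the resulting mixed dyads include all matrix units. *)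
Lemma linmap_tens_polar p q r (D : 'M[C]_(p * q) -> 'M[C]_r) : linmap D ->
  (forall (x : 'cV_p) (e : 'cV_q), D ((x *m adj x) *t (e *m adj e)) = 0) ->
  forall R, D R = 0.
Proof.
move=> lD h.
have h1 (x z : 'cV_p) (e : 'cV_q) : D ((x *m adj z) *t (e *m adj e)) = 0.
  apply: (@linmap_polar _ _ _ (fun S => D (S *t (e *m adj e))) _ _ x z) => // c S T.
  rewrite -lD; congr D; apply/matrixP => i j.
  by rewrite !mxE mulrDl mulrA.
have h2 (x z : 'cV_p) (e f : 'cV_q) : D ((x *m adj z) *t (e *m adj f)) = 0.
  apply: (@linmap_polar _ _ _ (fun S => D ((x *m adj z) *t S)) _ _ e f) => // c S T.
  rewrite -lD; congr D; apply/matrixP => i j.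
  by rewrite !mxE mulrDr mulrCA.
move=> R; rewrite [R]matrix_sum_delta (linmap_sum lD) big1 // => u _.
rewrite (linmap_sum lD) big1 // => v _; rewrite (linmapZ lD).
case: (mxtens_indexP u) => a s; case: (mxtens_indexP v) => b t.
rewrite -(mul_delta_mx (0 : 'I_1)) -dag_delta -!tensv_delta -tensv_dyad.
by rewrite h2 scaler0.
Qed.

End Isometries.

(** * The maps [U_i] are isometries *)

Section Main.
Variables (C : numClosedFieldType) (m n : nat) (dX : 'I_m -> nat) (dY : 'I_n -> nat).
Variables (dH : nat) (dE : 'I_n -> 'I_m -> nat).
Variable M : forall (i : 'I_m) (j : 'I_n), 'M[C]_(dX i * dH) -> 'M[C]_(dY j).
Hypothesis HM : is_channel M.
Variable tau : forall (i : 'I_m) (j : 'I_n), 'M[C]_(dY j * dE j i, dX i * dH).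
Hypothesis Mtau : forall i j S, M j S = ptrace (tau i j *m S *m adj (tau i j)).

(** Trace preservation of [M] reads [\tr (G *m S) = \tr S] for the Gram matrix [G], and dyads [S]
    recover each entry of [G]. *)
Lemma Umap_isometry i : qisometry (Umap tau i).
Proof.
rewrite /qisometry /Umap adj_mxcol mul_mxrow_mxcol; set G := \sum_j _.
apply/matrixP => a b; rewrite -sform_delta -[RHS]sform_delta.
have e S : \tr (G *m S) = \tr S.
  rewrite -(channel_tr HM S) /G mulmx_suml raddf_sum /=; apply: eq_bigr => j _.
  by rewrite Mtau trace_ptrace [RHS]mxtrace_mulC !mulmxA.
have e1 (Z : 'M[C]_(dX i * dH)) y w : sform Z y w = \tr (Z *m (w *m adj y)).
  by rewrite mulmxA tr_dyad mulmxA.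
by rewrite !e1 e mul1mx.
Qed.

End Main.

(** * The compression as a left inverse, for block isometries [V i j] with complete ranges *)

Section LeftInverse.
Variables (C : numClosedFieldType) (m n : nat) (dX : 'I_m -> nat) (dY : 'I_n -> nat).
Variables (dH : nat) (dE : 'I_n -> 'I_m -> nat).
Variable M : forall (i : 'I_m) (j : 'I_n), 'M[C]_(dX i * dH) -> 'M[C]_(dY j).
Hypothesis HM : is_channel M.
Variable W : 'M[C]_(dH * dH).
Hypothesis W_tr : \tr W = 1.
Variable T : forall (i : 'I_m) (j : 'I_n), 'M[C]_(dY j * dH, dX i * dE j i).
Hypothesis ampl_tensWE : forall i j r,
  ampl (M j) (tensW r W) = T i j *m (r *t (1%:M : 'M_(dE j i))) *m adj (T i j).
Variable kappa : forall (i : 'I_m) (j : 'I_n), 'M[C]_(dE j i).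
Hypothesis kappa_unit : forall i j, kappa i j \in unitmx.
Variable V : forall (i : 'I_m) (j : 'I_n), 'M[C]_(dY j * dH, dX i * dE j i).
Hypothesis VE : forall i j, V i j = T i j *m ((1%:M : 'M[C]_(dX i)) *t kappa i j).
Hypothesis Vblock_isometry : forall i j, adj (V i j) *m V i j = 1%:M.
Hypothesis Vblock_orthogonal : forall (i i' : 'I_m) j, i != i' -> adj (V i j) *m V i' j = 0.
Hypothesis Vblock_complete : forall j, \sum_i V i j *m adj (V i j) = 1%:M.

(** Convertible to [Nform] once [T i j] is [Tmat om (tau i j)]. *)
Definition compression j i (r : 'M[C]_(dY j * dH)) : 'M[C]_(dX i) :=
  let K := (1%:M : 'M[C]_(dX i)) *t kappa i j in
  ptrace (adj K *m adj (T i j) *m r *m T i j *m K).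

Lemma compressionE j i r : compression i r = ptrace (adj (V i j) *m r *m V i j).
Proof. by rewrite /compression VE dagM !mulmxA. Qed.

(** The trace of [sigma_ij], the operator on the environment that accompanies [r] in branch [j]. *)
Let weight i j := \tr (invmx (kappa i j) *m adj (invmx (kappa i j))).

Lemma T_Vblock i j : T i j = V i j *m ((1%:M : 'M[C]_(dX i)) *t invmx (kappa i j)).
Proof. by rewrite VE -mulmxA tensmx_mul mul1mx mulmxV // tens11 mulmx1. Qed.

Lemma ampl_tensWV i j r : ampl (M j) (tensW r (W))
  = V i j *m (r *t (invmx (kappa i j) *m adj (invmx (kappa i j)))) *m adj (V i j).
Proof.
rewrite ampl_tensWE T_Vblock dagM !mulmxA -(mulmxA (V i j)) -(mulmxA (V i j)).
by rewrite dag_tens dag1 !tensmx_mul mul1mx !mulmx1.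
Qed.

Lemma trace_ampl_tensW i r :
  \sum_j \tr (ampl (M j) (tensW (r : 'M_(dX i)) (W))) = \tr r.
Proof.
under eq_bigr do rewrite trace_blk.
rewrite exchange_big /=.
under eq_bigr => s _.
  under eq_bigr => j _.
    have -> : blk (ampl (M j) (tensW r (W))) s s = M j (r *t blk (W) s s).
      by apply/matrixP => a b; rewrite mxE amplE blk_tensW.
  over.
  rewrite (channel_tr HM) trace_tens.
over.
by rewrite -mulr_sumr -trace_blk W_tr mulr1.
Qed.

(** The trace of the output is computed in two ways. The factor [\tr r] keeps the identity true when
    [dX i] is zero. *)
Lemma sum_weight i (r : 'M[C]_(dX i)) : \sum_j weight i j * \tr r = \tr r.
Proof.
rewrite -[RHS]trace_ampl_tensW; apply: eq_bigr => j _.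
rewrite ampl_tensWV -mulmxA mxtrace_mulC -mulmxA Vblock_isometry mulmx1.
by rewrite trace_tens mulrC.
Qed.

Lemma compression_ent_left_inverse :
  ent_left_inverse M (W) compression.
Proof.
split; last first.
  move=> r t; under eq_bigr => j _.
    rewrite compressionE.
    have -> : adj (V t j) *m (\sum_i ampl (M j) (tensW (r i) (W))) *m V t j
       = r t *t (invmx (kappa t j) *m adj (invmx (kappa t j))).
      rewrite mulmx_sumr mulmx_suml (bigD1 t) //= big1 ?addr0 => [|i it].
        rewrite ampl_tensWV !mulmxA Vblock_isometry mul1mx.
        by rewrite -!mulmxA Vblock_isometry mulmx1.
      by rewrite ampl_tensWV !mulmxA Vblock_orthogonal 1?eq_sym // !mul0mx.
    rewrite ptrace_tens.
  over.
  rewrite -scaler_suml.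
  have [X0|X0] := posnP (dX t).
    by apply/matrixP => a b; exfalso; case: a => a; rewrite X0.
  (* A matrix unit of trace one shows that the weights sum to [1]. *)
  have := sum_weight (delta_mx (Ordinal X0) (Ordinal X0)).
  rewrite (_ : \tr (delta_mx _ _) = 1); last first.
    rewrite /mxtrace (bigD1 (Ordinal X0)) //= mxE !eqxx big1 ?addr0 // => a aX.
    by rewrite mxE (negPf aX).
  by under eq_bigr do rewrite mulr1; rewrite /weight => ->; rewrite scale1r.
split; [|split].
- move=> j i c S S'; rewrite !compressionE; exact: ptrace_conj_linmap.
- move=> k r hr i; apply: psd_sum => j _.
  have := ptrace_conj_cp (V i j) (hr j); congr (psd _).
  rewrite /ampl; apply: eq_bigr => s _; apply: eq_bigr => t _; by rewrite compressionE.
(* Trace preservation: cyclicity gathers the range projections of the [V i j], which sum to the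
   identity. *)
- move=> r; under eq_bigr do rewrite raddf_sum /=.
  rewrite exchange_big /=; apply: eq_bigr => j _.
  under eq_bigr => i _ do rewrite compressionE trace_ptrace -mulmxA mxtrace_mulC -mulmxA.
  rewrite -raddf_sum -mulmx_sumr /=.
  by rewrite Vblock_complete mulmx1.
Qed.

(** * Uniqueness of the left inverse *)

Section Uniqueness.
Variable N : forall (j : 'I_n) (i : 'I_m), 'M[C]_(dY j * dH) -> 'M[C]_(dX i).
Hypothesis HN : ent_left_inverse M (W) N.

Let Nlin j i : linmap (@N j i) := @channel_lin C n m _ _ N HN.1 j i.

(** The premise covers both [i != t] and [x] orthogonal to [y]. The form at [y] of the recovered
    component [t] is a sum of nonnegative terms over branches and environment basis vectors, so each
    term is zero; [pos_ker_sum] passes to any [e]. *)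
Lemma left_inverse_ker j t (y : 'cV[C]_(dX t)) i (x : 'cV[C]_(dX i)) :
  sform (dfwith (fun i => 0 : 'M[C]_(dX i)) (x *m adj x) t) y y = 0 ->
  forall e w,
    sform (N t ((T i j *m tensv x e) *m adj w)) y y = 0 /\
    sform (N t (w *m adj (T i j *m tensv x e))) y y = 0.
Proof.
set r := dfwith _ _ => hy e w.
have := HN.2 r t; move/(congr1 (fun Z => sform Z y y)); rewrite hy sform_sum.
pose v j l := T i j *m tensv x (delta_mx l 0).
have vE j' : \sum_i' ampl (M j') (tensW (r i') (W)) = \sum_l v j' l *m adj (v j' l).
  rewrite (bigD1 i) //= big1 ?addr0 => [|i' i'i].
    rewrite ampl_tensWE /r dfwith_in dyad_tens1 mulmx_sumr mulmx_suml.
    by apply: eq_bigr => l _; rewrite /v dagM !mulmxA.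
  by rewrite ampl_tensWE /r dfwith_out 1?eq_sym // tens0mx mulmx0 mul0mx.
have vpos j' l : 0 <= sform (N t (v j' l *m adj (v j' l))) y y.
  exact: channel_pos HN.1 _ _ _ (psd_dyad _) _.
under eq_bigr => j' _ do rewrite vE (linmap_sum (@Nlin _ _)) sform_sum.
move/eqP; rewrite psumr_eq0; last by move=> j' _; apply: sumr_ge0 => l _.
move=> /allP/(_ j (mem_index_enum _)) /=; rewrite psumr_eq0 // => /allP hl.
have -> : T i j *m tensv x e = \sum_l e l 0 *: v j l.
  by rewrite tensv_sum mulmx_sumr; apply: eq_bigr => l _; rewrite -scalemxAr.
apply: (pos_ker_sum (@Nlin j t)) => [S hS|l]; first exact: channel_pos HN.1 _ _ _ hS.
by apply/eqP; apply: hl; apply: mem_index_enum.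
Qed.

Lemma Vblock_tensv i j (x : 'cV[C]_(dX i)) e :
  V i j *m tensv x e = T i j *m tensv x (kappa i j *m e).
Proof. by rewrite VE -mulmxA mul_1tens_tensv. Qed.

(** The input in summand [i] has zero component at [t], so [left_inverse_ker] holds for every [y].
    The free size [q] serves both [A = adj (V i j)] and [A] a product vector. *)
Lemma left_inverse_off j t i q (A : 'M[C]_(_, q)) (B : 'M[C]_(q, _)) : i != t ->
  N t (V i j *m A *m B) = 0 /\ N t (adj B *m adj A *m adj (V i j)) = 0.
Proof.
move=> it.
have k u (w : 'cV_(dY j * dH)) : N t ((V i j *m (delta_mx u 0 : 'cV_(dX i * dE j i))) *m adj w) = 0 /\
     N t (w *m adj (V i j *m (delta_mx u 0 : 'cV_(dX i * dE j i)))) = 0.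
  (* Basis vectors are product vectors, and [kappa] changes only their second factor. *)
  case: (mxtens_indexP u) => a s; rewrite -tensv_delta Vblock_tensv.
  pose x := delta_mx a 0 : 'cV[C]_(dX i).
  have z y : sform (dfwith (fun i => 0 : 'M[C]_(dX i)) (x *m adj x) t) y y = 0.
    by rewrite dfwith_out // sform0.
  by split; apply: sform_eq0 => y;
    have [] := @left_inverse_ker j _ _ _ _ (z y) (kappa i j *m delta_mx s 0) w.
rewrite -mulmxA -!dagM mulmx_col_row; split.
  rewrite (linmap_sum (@Nlin j t)) big1 // => u _.
  by rewrite colE -[row u _]dagK (k _ _).1.
rewrite (big_morph (@adj C _ _) (id1 := 0) (op1 := +%R)); first last.
- exact: dag0.
- exact: dagD.
rewrite (linmap_sum (@Nlin j t)) big1 // => u _.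
by rewrite colE dagM (k _ _).2.
Qed.

(** By polarization product dyads suffice; there [psd_rank1] fixes the direction of the output and
    its trace fixes the scalar. *)
Lemma left_inverse_diag j t (R : 'M[C]_(dX t * dE j t)) :
  N t (V t j *m R *m adj (V t j)) = ptrace R.
Proof.
apply/eqP; rewrite -subr_eq0; apply/eqP; move: R.
apply: linmap_tens_polar => [c R S|x e].
  rewrite mulmxDr mulmxDl -scalemxAr -scalemxAl (linmapD (@Nlin j t)) (linmapZ (@Nlin j t)).
  by rewrite ptraceD ptraceZ scalerBr opprD addrACA.
rewrite ptrace_tens tr_dyad tensv_dyad mulmxA -mulmxA -dagM.
set v := V t j *m _; set g := (adj e *m e) 0 0; set d := (adj x *m x) 0 0.
have hv : (adj v *m v) 0 0 = d * g.
  by rewrite dagM -mulmxA (mulmxA (adj (V t j))) Vblock_isometry mul1mx dot_tensv.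
have e1 : d ^+ 2 *: N t (v *m adj v) = sform (N t (v *m adj v)) x x *: (x *m adj x).
  apply: psd_rank1 => [|y yx]; first (apply: (channel_pos HN.1); exact: psd_dyad).
  have z : sform (dfwith (fun i => 0 : 'M[C]_(dX i)) (x *m adj x) t) y y = 0.
    by rewrite dfwith_in sform_dyad yx mul0r.
  by have [] := @left_inverse_ker j _ _ _ _ z (kappa t j *m e) v; rewrite -Vblock_tensv.
(* The whole trace lands in component [t], as [left_inverse_off] annihilates the others. *)
have e2 : \tr (N t (v *m adj v)) = d * g.
  rewrite -hv -tr_dyad -(channel_tr HN.1) (bigD1 t) //= big1 ?addr0 // => t' t't.
  by rewrite {1}/v (left_inverse_off _ _ _).1 ?mxtrace0 // eq_sym.
have [d0|d0] := eqVneq d 0.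
  have v0 : v = 0 by apply: dot_eq0; rewrite hv d0 mul0r.
  by rewrite v0 mul0mx (linmap0 (@Nlin j t)) (dot_eq0 d0) mul0mx scaler0 subrr.
have := congr1 mxtrace e1; rewrite !linearZ /= e2 tr_dyad -/d => e3.
have e4 : sform (N t (v *m adj v)) x x = d ^+ 2 * g.
  by apply: (mulIf d0); rewrite -e3; ring.
have d2 : d ^+ 2 != 0 by rewrite expf_neq0.
suff -> : N t (v *m adj v) = g *: (x *m adj x) by rewrite scalerN subrr.
by apply: (scalerI d2); rewrite e1 e4 scalerA.
Qed.

(** Inserting the complete family of range projections on each side of [S] leaves only the [t]
    block, where [left_inverse_diag] applies. *)
Lemma left_inverse_unique (j : 'I_n) (t : 'I_m) (S : 'M[C]_(dY j * dH)) :
  N t S = compression t S.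
Proof.
have compl (R : 'M[C]_(dY j * dH)) : N t R = N t (V t j *m adj (V t j) *m R).
  rewrite -{1}[R]mul1mx -(Vblock_complete j) mulmx_suml (linmap_sum (@Nlin j t)).
  by rewrite (bigD1 t) //= big1 ?addr0 // => i it; rewrite (left_inverse_off _ _ it).1.
have compr (R : 'M[C]_(dY j * dH)) : N t R = N t (R *m V t j *m adj (V t j)).
  rewrite -{1}[R]mulmx1 -(Vblock_complete j) mulmx_sumr (linmap_sum (@Nlin j t)).
  rewrite (bigD1 t) //= big1 ?addr0 ?mulmxA // => i it.
  by have [_] := left_inverse_off (adj (V i j)) (adj R) it; rewrite !dagK mulmxA.
rewrite compl compr compressionE -left_inverse_diag.
by rewrite !mulmxA.
Qed.

End Uniqueness.

End LeftInverse.

(** * Dimension counting in natural numbers *)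

Section Dimensions.
Variables (m n k : nat) (x : 'I_m -> nat) (y : 'I_n -> nat) (e : 'I_n -> 'I_m -> nat).
Hypothesis k_gt0 : (0 < k)%N.
Hypothesis leU : forall i, (x i * k <= \sum_j y j * e j i)%N.
Hypothesis leV : forall j, (\sum_i x i * e j i <= y j * k)%N.

Let dimA := (\sum_i x i ^ 2)%N.
Let dimB := (\sum_j y j ^ 2)%N.
(** The bounds [leU] weighted by [x i] and [leV] weighted by [y j] meet at this number. *)
Let mid := (\sum_i \sum_j x i * y j * e j i)%N.

Let dimAE : (dimA * k = \sum_i x i * (x i * k))%N.
Proof. by rewrite big_distrl; apply: eq_bigr => i _ /=; rewrite -mulnn mulnA. Qed.

Let midEA : (mid = \sum_i x i * \sum_j y j * e j i)%N.
Proof. by apply: eq_bigr => i _; rewrite big_distrr; apply: eq_bigr => j _ /=; rewrite mulnA. Qed.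

Let midEB : (mid = \sum_j y j * \sum_i x i * e j i)%N.
Proof.
rewrite /mid exchange_big; apply: eq_bigr => j _; rewrite big_distrr; apply: eq_bigr => i _ /=.
by rewrite mulnCA mulnA.
Qed.

Let dimBE : (dimB * k = \sum_j y j * (y j * k))%N.
Proof. by rewrite big_distrl; apply: eq_bigr => j _ /=; rewrite -mulnn mulnA. Qed.

Let leA : (dimA * k <= mid)%N.
Proof. by rewrite dimAE midEA; apply: leq_sum => i _; rewrite leq_mul2l leU orbT. Qed.

Let leB : (mid <= dimB * k)%N.
Proof. by rewrite dimBE midEB; apply: leq_sum => j _; rewrite leq_mul2l leV orbT. Qed.

Lemma dim_le : (dimA <= dimB)%N.
Proof. by rewrite -(leq_pmul2r k_gt0) (leq_trans leA). Qed.

(** Equality collapses [dimA * k <= mid <= dimB * k], so every weighted inequality is tight and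
    positive weights cancel. *)
Lemma dim_eqP :
  (forall i, x i = 0 -> \sum_j y j * e j i = 0)%N ->
  (dimA = dimB <-> (forall i, \sum_j y j * e j i = x i * k)%N
                /\ (forall j, y j * k = \sum_i x i * e j i)%N).
Proof.
move=> x0; split=> [AB | [eU eV]]; last first.
  apply/eqP; rewrite -(eqn_pmul2r k_gt0) dimAE dimBE.
  under eq_bigr do rewrite -eU; under [X in _ == X]eq_bigr do rewrite eV.
  by rewrite -midEA -midEB.
have sumE (I : finType) (F G : I -> nat) : (forall i, F i <= G i)%N ->
    (\sum_i G i <= \sum_i F i)%N -> forall i, F i = G i.
  move=> le le' i; apply/eqP; rewrite eqn_leq le /= leqNgt; apply: contraL le' => lt.
  rewrite -ltnNge (bigD1 i) //= [ltnRHS](bigD1 i) //= -addSn leq_add //.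
  by apply: leq_sum => i' _; apply: le.
split=> [i | j].
  (* A zero weight carries no information, hence the premise [x0]; for [y j = 0] the bound [leV]
     itself suffices. *)
  have [/eqP xi0 | xi] := posnP (x i); first by rewrite (eqP xi0) x0 //; apply/eqP.
  apply/eqP; rewrite -(eqn_pmul2l xi) eq_sym; apply/eqP; move: i xi.
  have := @sumE _ (fun i => x i * (x i * k))%N (fun i => x i * \sum_j y j * e j i)%N.
  move=> h i _; apply: h i => [i|]; first by rewrite leq_mul2l leU orbT.
  by rewrite -midEA -dimAE AB.
have [yj0 | yj] := posnP (y j).
  by apply/eqP; rewrite eqn_leq leV andbT yj0.
apply/eqP; rewrite -(eqn_pmul2l yj) eq_sym; apply/eqP; move: j yj.
have := @sumE _ (fun j => y j * \sum_i x i * e j i)%N (fun j => y j * (y j * k))%N.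
move=> h j _; apply: h j => [j|]; first by rewrite leq_mul2l leV orbT.
by rewrite -midEB -dimBE -AB.
Qed.
End Dimensions.

(** Kraus components on the zero space vanish, so their independence forces an empty environment.
    This supplies the premise of [dim_eqP] for summands with [dX i = 0]. *)
Lemma minimal_dilation0 (C : numClosedFieldType) px py e h
    (Phi : 'M[C]_(px * h) -> 'M[C]_py) (tau : 'M[C]_(py * e, px * h)) :
  minimal_dilation Phi tau -> px = 0%N -> e = 0%N.
Proof.
move=> [_ indep] px0; have [//|e0] := posnP e.
suff /eqP : (1 : C) = 0 by rewrite oner_eq0.
apply: (indep (fun=> 1) _ (Ordinal e0)).
by apply/matrixP => a b; exfalso; case: b => b; rewrite px0.
Qed.

(** * Dimension count and left inverse combined *)

Theorem mainTheorem4 (C : numClosedFieldType)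
  (m n : nat) (dX : 'I_m -> nat) (dY : 'I_n -> nat) (dH : nat)
  (dE : 'I_n -> 'I_m -> nat)
  (M : forall (i : 'I_m) (j : 'I_n), 'M[C]_(dX i * dH) -> 'M[C]_(dY j))
  (HM : is_channel M)
  (tau : forall (i : 'I_m) (j : 'I_n), 'M[C]_(dY j * dE j i, dX i * dH))
  (Htau : forall i j, minimal_dilation (M i j) (tau i j))
  (om : 'M[C]_dH) (Hom_inv : om \in unitmx) (Hom_tr : \tr (adj om *m om) = 1)
  (Hrev : ent_reversible M (Wom om))
  (kappa : forall (i : 'I_m) (j : 'I_n), 'M[C]_(dE j i))
  (Hkappa : forall i j, kappa i j \in unitmx)
  (HV : forall j, qisometry (Vmap om tau kappa j)) :
  let dimA := (\sum_(i < m) (dX i) ^ 2)%N in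
  let dimB := (\sum_(j < n) (dY j) ^ 2)%N in
  (forall i, qisometry (Umap tau i)) /\
  (dimA <= dimB)%N /\
  (((forall i, qunitary (Umap tau i)) /\ (forall j, qunitary (Vmap om tau kappa j)))
     <-> dimA = dimB) /\
  (dimA = dimB ->
     ent_left_inverse M (Wom om) (Nform om tau kappa) /\
     forall N : forall (j : 'I_n) (i : 'I_m), 'M[C]_(dY j * dH) -> 'M[C]_(dX i),
       ent_left_inverse M (Wom om) N ->
       forall j i (r : 'M[C]_(dY j * dH)), N j i r = Nform om tau kappa j i r).
Proof.
move=> dimA dimB.
have Mtau i j S : M i j S = ptrace (tau i j *m S *m adj (tau i j)) by have [] := Htau i j.
have HU := Umap_isometry HM Mtau.
have dH_gt0 : (0 < dH)%N.
  (* For [dH = 0] the trace in [Hom_tr] would be an empty sum. *)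
  case: posnP Hom_tr => // dH0 /eqP; rewrite /mxtrace big1 ?(eq_sym 0) ?oner_eq0 // => a.
  by exfalso; case: a => a; rewrite dH0.
have leU i := qisometry_leq (HU i); have leV j := qisometry_leq (HV j).
have X0 i : dX i = 0%N -> (\sum_j dY j * dE j i = 0)%N.
  by move=> Xi0; apply: big1 => j _; rewrite (minimal_dilation0 (Htau i j) Xi0) muln0.
have unitP : ((forall i, qunitary (Umap tau i)) /\ (forall j, qunitary (Vmap om tau kappa j)))
     <-> dimA = dimB.
  rewrite /dimA /dimB (dim_eqP dH_gt0 leU leV X0).
  by split=> -[hU hV]; split=> [i | j];
    [move/qunitaryP: (hU i) | move/qunitaryP: (hV j)
    | apply/qunitaryP | apply/qunitaryP]; auto.
split=> //; split; first exact: dim_le dH_gt0 leU leV.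
split=> // /unitP[_ Vunit].
pose T i j := Tmat om (tau i j).
pose V i j := T i j *m ((1%:M : 'M[C]_(dX i)) *t kappa i j).
have [Viso Vorth] : (forall i j, adj (V i j) *m V i j = 1%:M) /\
    (forall (i i' : 'I_m) j, i != i' -> adj (V i j) *m V i' j = 0).
  split=> [i j | i i' j]; have [iso orth] := qisometry_mxrow (B := fun i => V i j) (HV j).
    exact: iso.
  exact: orth.
(* This is the half of unitarity that equal dimensions add to the isometry property. *)
have Vcomplete j : \sum_i V i j *m adj (V i j) = 1%:M.
  by have [_] := Vunit j; rewrite /Vmap adj_mxrow mul_mxrow_mxcol.
have trW : \tr (Wom om) = 1 by rewrite trace_Wom.
have amplWE i j r := ampl_tensW om r (Mtau i j).
split=> [|N HN j i r].
  exact: (compression_ent_left_inverse HM trW amplWE Hkappa _ Viso Vorth Vcomplete).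
exact: (left_inverse_unique amplWE _ Viso Vcomplete HN).
Qed.
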